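(* Let $R$ be a ring and $I$ an ideal of $R$. Consider the following conditions: (1) Every finitely generated left $R$-module is $I$-supplemented. (2) Every finitely generated projective left $R$-module is $I$-supplemented. (3) Every finitely generated projective left $R$-module is $I$-lifting. (4) ${}_RR$ is $I$-lifting. (5) ${}_RR$ is $I$-supplemented. (6) $R$ is $I$-semiperfect. Then $(1)\Rightarrow(2)\Rightarrow(5)\Rightarrow(6)$ and $(3)\Rightarrow(4)\Rightarrow(5)$. If moreover $R$ is a left PSD ring for $I$, then also $(2)\Rightarrow(3)$ and $(6)\Rightarrow(1)$.
   Context: Rings are associative with identity; modules are unital left modules; $I$ is a two-sided ideal of $R$. A submodule $N\le M$ is PSD in $M$ if for every submodule $X\le M$ with $N+X=M$ there is a projective direct summand $S$ of $M$ (depending on $X$) with $S\le N$ and $M=S\oplus X$. $M$ is PSD for $I$ if every submodule of $IM$ is PSD in $M$. $R$ is a left PSD ring for $I$ if every finitely generated free left $R$-module is PSD for $I$. $M$ is $I$-supplemented if for every submodule $X\le M$ there is a submodule $Y\le M$ with $X+Y=M$, $X\cap Y\subseteq IY$ and $X\cap Y$ PSD in $Y$. $M$ is $I$-lifting if for every submodule $X\le M$ there is a decomposition $M=A\oplus B$ with $A\subseteq X$, $X\cap B\subseteq IB$ and $X\cap B$ PSD in $B$. $M$ is $I$-semiperfect if for every submodule $K\le M$ there is a decomposition $M=A\oplus B$ with $A$ projective, $A\subseteq K$ and $K\cap B\subseteq IM$. The ring $R$ is $I$-semiperfect if ${}_RR$ is an $I$-semiperfect module. *)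

(* Defs.v *)
From HB Require Import structures.
From mathcomp Require Import all_boot all_order all_algebra.
From mathcomp Require Import boolp classical_sets.
Set Implicit Arguments.
Unset Strict Implicit.
Unset Printing Implicit Defensive.
Import GRing.Theory.
Local Open Scope classical_set_scope.
Local Open Scope ring_scope.

Definition two_sided_ideal (R : pzRingType) (I : set R) : Prop :=
  [/\ I 0, forall a b, I a -> I b -> I (a + b),
      forall r a, I a -> I (r * a) & forall r a, I a -> I (a * r)].

Section Modules.
Variable R : pzRingType.
Implicit Types (I : set R) (M : lmodType R).

(* Submodules are Prop-valued sets, so no decidability of membership is
   required; x \in N is the boolean reflection of N x. *)
Record submodule M := Submodule {
  submod_set :> set M;
  submod_setP : submod_closed (fun x : M => x \in submod_set) }.

Definition submod_pred M (N : submodule M) : {pred M} :=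
  fun x => x \in submod_set N.

HB.instance Definition _ M (N : submodule M) :=
  GRing.isSubmodClosed.Build R M (submod_pred N) (submod_setP N).

(* A submodule as a left R-module in its own right. *)
Definition submod_type M (N : submodule M) : Type := {x : M | submod_pred N x}.

HB.instance Definition _ M (N : submodule M) :=
  [isSub of submod_type N for @sval M (submod_pred N)].
HB.instance Definition _ M (N : submodule M) :=
  [Choice of submod_type N by <:].
#[warnings="-redundant-canonical-projection"]
HB.instance Definition _ M (N : submodule M) :=
  [SubChoice_isSubLmodule of submod_type N by <:].

Lemma submod_inter_closed M (X Y : submodule M) :
  submod_closed
    (fun y : submod_type Y => y \in (\val : submod_type Y -> M) @^-1` X).
Proof.
have [X0 XL] := submod_setP X.
have val0 : \val (0 : submod_type Y) = 0 :> M by rewrite raddf0.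
have valL a (u v : submod_type Y) :
  \val (a *: u + v) = a *: \val u + \val v :> M by rewrite linearP.
split; first by apply/mem_set; rewrite /preimage /mkset val0; apply: set_mem.
move=> a u v /set_mem Xu /set_mem Xv; apply/mem_set.
rewrite /preimage /mkset valL; apply: set_mem.
by apply: XL; apply/mem_set.
Qed.

(* X `&` Y, seen as a submodule of the module Y. *)
Definition submod_inter M (X Y : submodule M) : submodule (submod_type Y) :=
  Submodule (submod_inter_closed X Y).

Definition sums_to_all M (X Y : submodule M) : Prop :=
  [set x + y | x in X & y in Y] = [set: M].

Definition decomposes M (A B : submodule M) : Prop :=
  sums_to_all A B /\ A `&` B = [set 0].

Definition ideal_mul I M : set M :=
  [set x | exists s : seq (R * M),
     (forall p, p \in s -> I p.1) /\ x = \sum_(p <- s) p.1 *: p.2].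
#[global] Arguments ideal_mul I M : clear implicits.

Definition spans M (B : set M) : Prop :=
  forall x : M, exists (s : seq M) (c : M -> R),
    [set` s] `<=` B /\ x = \sum_(b <- s) c b *: b.

Definition lin_indep M (B : set M) : Prop :=
  forall (s : seq M) (c : M -> R), uniq s -> [set` s] `<=` B ->
    \sum_(b <- s) c b *: b = 0 -> forall b, b \in s -> c b = 0.

Definition fin_generated M : Prop := exists s : seq M, spans [set` s].

Definition free_module M : Prop :=
  exists B : set M, spans B /\ lin_indep B.

Definition projective M : Prop :=
  forall (U V : lmodType R) (g : {linear U -> V}) (f : {linear M -> V}),
    (forall v, exists u, g u = v) ->
    exists h : {linear M -> U}, forall x, g (h x) = f x.

(* S is automatically a direct summand of M, with complement X. *)
Definition PSD M (N : submodule M) : Prop :=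
  forall X : submodule M, sums_to_all N X ->
    exists S : submodule M,
      [/\ projective (submod_type S), S `<=` N & decomposes S X].

Definition PSD_for I M : Prop :=
  forall N : submodule M, N `<=` ideal_mul I M -> PSD N.

Definition left_PSD_ring I : Prop :=
  forall F : lmodType R, fin_generated F -> free_module F -> PSD_for I F.

Definition supplemented I M : Prop :=
  forall X : submodule M, exists Y : submodule M,
    [/\ sums_to_all X Y,
        submod_inter X Y `<=` ideal_mul I (submod_type Y)
      & PSD (submod_inter X Y)].

Definition lifting I M : Prop :=
  forall X : submodule M, exists A B : submodule M,
    [/\ decomposes A B, A `<=` X,
        submod_inter X B `<=` ideal_mul I (submod_type B)
      & PSD (submod_inter X B)].

Definition semiperfect_module I M : Prop :=
  forall K : submodule M, exists A B : submodule M,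
    [/\ decomposes A B, projective (submod_type A), A `<=` K
      & K `&` B `<=` ideal_mul I M].

Definition semiperfect_ring I : Prop := semiperfect_module I R^o.

End Modules.

Arguments ideal_mul {R} I M _ : rename.

(* Main.v *)
(* A submodule N is PSD in M iff M / X is projective whenever N + X = M. Hence
   PSD submodules are stable under subsets, finite sums and images under
   arbitrary linear maps.
   Let M be projective and I-supplemented, and K <= M. Take a supplement Y of K
   and a supplement Y' <= K of Y. The map Y * Y' -> M splits and its kernel is
   PSD, so Y * Y' is the product of M with a projective module; thus Y is
   projective. A lift M -> Y of the projection onto M / K has a projective
   image, and its kernel is the summand of M inside K required for lifting (and
   a fortiori for I-semiperfect) modules.
   For (6) => (1), PSD-ness of R turns semiperfectness into supplementedness of
   R, which passes to finitely generated modules by adding generators one at a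
   time: a supplement of U + Ra plus the image of one in R yields one of U. *)
Require Import Defs.
From HB Require Import structures.
From mathcomp Require Import all_boot all_order all_algebra.
From mathcomp Require Import boolp classical_sets.
Local Open Scope ring_scope.

Section Supplements.
Import GRing.Theory.
Local Open Scope classical_set_scope.
Set Implicit Arguments.
Unset Strict Implicit.
Unset Printing Implicit Defensive.
#[local] Identity Coercion fun_of_set : set >-> Funclass.
Variable R : pzRingType.
Implicit Types (I : set R) (M P Q : lmodType R).

(** * Linear maps and submodules *)

Lemma linear_ex M P (f : M -> P) :
  linear f -> exists g : {linear M -> P}, g =1 f.
Proof.
move=> fL.
pose g : {linear M -> P} :=
  HB.pack f (GRing.isLinear.Build R M P *:%R f fL).
by exists g.
Qed.

Lemma submodule_closed M (S : set M) :
  S 0 -> (forall a x y, S x -> S y -> S (a *: x + y)) ->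
  submod_closed (fun x : M => x \in S).
Proof.
move=> S0 SL; split; first exact/mem_set.
by move=> a x y /set_mem Sx /set_mem Sy; apply/mem_set/SL.
Qed.

Section SubmoduleTheory.
Variables (M : lmodType R) (N : submodule M).

Lemma submod0 : N 0.
Proof. by case: (submod_setP N) => /set_mem. Qed.

Lemma submodL a x y : N x -> N y -> N (a *: x + y).
Proof.
by case: (submod_setP N) => _ H Nx Ny; apply/set_mem/H; apply/mem_set.
Qed.

Lemma submodD x y : N x -> N y -> N (x + y).
Proof. by move=> Nx Ny; rewrite -[x]scale1r; apply: submodL. Qed.

Lemma submodZ a x : N x -> N (a *: x).
Proof. by move=> Nx; rewrite -[_ *: _]addr0; apply: submodL submod0. Qed.

Lemma submodN x : N x -> N (- x).
Proof. by move=> Nx; rewrite -scaleN1r; apply: submodZ. Qed.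

Lemma submodB x y : N x -> N y -> N (x - y).
Proof. by move=> Nx Ny; apply/submodD/submodN. Qed.

Lemma submodBr x y : N x -> N (x - y) -> N y.
Proof. by move=> Nx Nxy; rewrite -[y](subKr x); apply: submodB. Qed.

Lemma submod_valP (x : submod_type N) : N (\val x).
Proof. by apply/set_mem; exact: (valP x). Qed.

Lemma submod_valL a (x y : submod_type N) :
  \val (a *: x + y) = a *: \val x + \val y :> M.
Proof. exact: linearP. Qed.

Lemma submod_val0 : \val (0 : submod_type N) = 0 :> M.
Proof. exact: raddf0. Qed.

Lemma submod_lift Q (f : {linear Q -> M}) : (forall q, N (f q)) ->
  exists g : {linear Q -> submod_type N}, forall q, \val (g q) = f q.
Proof.
move=> Nf.
have Nf' q : submod_pred N (f q) by apply/mem_set/Nf.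
pose g q : submod_type N := Sub (f q) (Nf' q).
have [|h hE] := @linear_ex Q (submod_type N) g.
  by move=> a x y; apply: val_inj; rewrite submod_valL !SubK linearP.
by exists h => q; rewrite hE.
Qed.

End SubmoduleTheory.

Lemma img_closed Q M (f : {linear Q -> M}) (N : submodule Q) :
  submod_closed (fun x : M => x \in f @` N).
Proof.
apply: submodule_closed; first by exists 0; [exact: submod0|rewrite linear0].
move=> a _ _ [x Nx <-] [y Ny <-].
by exists (a *: x + y); [exact: submodL|rewrite linearP].
Qed.
Definition img Q M (f : {linear Q -> M}) (N : submodule Q) : submodule M :=
  Submodule (img_closed f N).

Lemma preim_closed Q M (f : {linear Q -> M}) (N : submodule M) :
  submod_closed (fun x : Q => x \in f @^-1` N).
Proof.
apply: submodule_closed; first by rewrite /preimage /= linear0; exact: submod0.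
by move=> a x y; rewrite /preimage /= linearP; exact: submodL.
Qed.
Definition preim Q M (f : {linear Q -> M}) (N : submodule M) : submodule Q :=
  Submodule (preim_closed f N).

Lemma zero_closed M : submod_closed (fun x : M => x \in [set 0 : M]).
Proof.
by apply: submodule_closed => //= a x y -> ->; rewrite scaler0 addr0.
Qed.
Definition zero_submod M : submodule M := Submodule (@zero_closed M).

Lemma full_closed M : submod_closed (fun x : M => x \in [set: M]).
Proof. by apply: submodule_closed. Qed.
Definition full_submod M : submodule M := Submodule (@full_closed M).

Lemma sum_closed M (X Y : submodule M) :
  submod_closed (fun x : M => x \in [set x + y | x in X & y in Y]).
Proof.
apply: submodule_closed.
  by exists 0; [exact: submod0|exists 0; [exact: submod0|rewrite addr0]].
move=> a _ _ [x Xx [y Yy <-]] [x' Xx' [y' Yy' <-]].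
exists (a *: x + x'); [exact: submodL|exists (a *: y + y'); first exact: submodL].
by rewrite scalerDr addrACA.
Qed.
Definition sum_submod M (X Y : submodule M) : submodule M :=
  Submodule (sum_closed X Y).

(** * Sums, decompositions and projections *)

Lemma sums_to_allP M (X Y : submodule M) :
  sums_to_all X Y <-> forall m, exists2 x, X x & Y (m - x).
Proof.
split=> [XY m|XY].
  have [x Xx [y Yy <-]] : [set x + y | x in X & y in Y] m by rewrite XY.
  by exists x => //; rewrite addrC addKr.
apply/seteqP; split=> // m _; have [x Xx Ym] := XY m.
by exists x => //; exists (m - x) => //; rewrite addrC subrK.
Qed.

Lemma sums_to_allC M (X Y : submodule M) : sums_to_all X Y -> sums_to_all Y X.
Proof.
move=> /sums_to_allP XY; apply/sums_to_allP => m; have [x Xx Ym] := XY m.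
by exists (m - x) => //; rewrite opprB addrC subrK.
Qed.

(** Since [A] and [B] meet in 0, the component in [A] is unique, so a function choosing it is
    automatically linear. *)
Lemma projection_ex M (A B : submodule M) : decomposes A B ->
  exists p : {linear M -> M},
    [/\ forall m, A (p m), forall m, B (m - p m) & forall a, A a -> p a = a].
Proof.
move=> [/sums_to_allP AB AB0].
have uniqA x y : A x -> B (y - x) -> A y -> x = y.
  move=> Ax Bxy Ay; apply/esym/eqP; rewrite -subr_eq0; apply/eqP.
  have : (A `&` B) (y - x) by split=> //; apply: submodB.
  by rewrite AB0.
have /choice[p pP] m : exists x, A x /\ B (m - x).
  by have [x Ax Bx] := AB m; exists x.
have [|q qE] := @linear_ex _ _ p.
  move=> a x y; have [Ax Bx] := pP x; have [Ay By] := pP y.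
  have [Axy Bxy] := pP (a *: x + y).
  apply: uniqA => //; last exact: submodL.
  have -> : a *: p x + p y - p (a *: x + y) =
     (a *: x + y - p (a *: x + y)) - (a *: (x - p x) + (y - p y)).
    rewrite scalerBr addrACA -opprD [RHS]addrAC opprB.
    by rewrite [_ + (_ - _)]addrC subrK.
  by apply: submodB => //; apply: submodL.
exists q; split=> m; rewrite qE; [by case: (pP m)|by case: (pP m)|].
by move=> Am; have [? ?] := pP m; apply: uniqA.
Qed.

(** * Projective modules: retracts, products and sections *)

Lemma projective_retract M P (f : {linear P -> M}) (g : {linear M -> P}) :
  (forall x, g (f x) = x) -> projective M -> projective P.
Proof.
move=> gf Mproj U V s t s_surj.
have [h hE] := Mproj U V s (t \o g)%FUN s_surj.
by exists (h \o f)%FUN => x; rewrite /= hE /= gf.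
Qed.

Lemma inl_linear_ex P Q :
  exists i : {linear P -> (P * Q)%type}, forall x, i x = (x, 0).
Proof.
apply: linear_ex => a x y.
by apply/pair_eqP; rewrite /= !eqxx scaler0 addr0 eqxx.
Qed.

Lemma inr_linear_ex P Q :
  exists i : {linear Q -> (P * Q)%type}, forall x, i x = (0, x).
Proof.
apply: linear_ex => a x y.
by apply/pair_eqP; rewrite /= !eqxx scaler0 addr0 eqxx.
Qed.

Lemma inl_inr P Q (x : (P * Q)%type) : (x.1, 0) + (0, x.2) = x.
Proof.
by case: x => x y; apply/pair_eqP; rewrite /= addr0 add0r !eqxx.
Qed.

Lemma copair_ex Q Q' M (j : {linear Q -> M}) (j' : {linear Q' -> M}) :
  exists g : {linear (Q * Q')%type -> M}, forall x, g x = j x.1 + j' x.2.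
Proof.
by apply: linear_ex => a x y; rewrite !linearP scalerDr addrACA.
Qed.

Lemma projective_prod P Q :
  projective P -> projective Q -> projective (P * Q)%type.
Proof.
move=> Pp Qp U V s t s_surj.
have [i iE] := inl_linear_ex P Q.
have [j jE] := inr_linear_ex P Q.
have [h hE] := Pp U V s (t \o i)%FUN s_surj.
have [k kE] := Qp U V s (t \o j)%FUN s_surj.
have [l lE] := copair_ex h k.
by exists l => x; rewrite lE linearD hE kE /= iE jE -linearD inl_inr.
Qed.

(** Projectivity is applied to the restriction of [g] to [N], which forces the section to take its
    values in [N]. *)
Lemma projective_section M P (g : {linear M -> P}) (N : submodule M) :
  projective P -> (forall p, exists2 x, N x & g x = p) ->
  exists2 h : {linear P -> M}, forall p, g (h p) = p & forall p, N (h p).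
Proof.
move=> Pp g_surj.
have [|h hE] := Pp _ _ (g \o \val : {linear submod_type N -> P}) idfun.
  move=> p; have [x Nx <-] := g_surj p.
  by exists (Sub x (mem_set Nx)).
exists (\val \o h : {linear P -> M}) => p; first exact: hE.
exact: submod_valP.
Qed.

(** * Stability properties of PSD submodules *)

(* [M / X] is projective, stated without forming the quotient. *)
Definition projective_coker M (X : submodule M) : Prop :=
  exists (P : lmodType R) (p : {linear M -> P}),
    [/\ projective P, forall y, exists x, p x = y & forall x, p x = 0 <-> X x].

(** A complement [S] of [X] is isomorphic to M / X. Conversely, when N + X = M, a section of M -> M
    / X can be chosen with values in [N], and its image is the required summand. *)
Lemma PSDP M (N : submodule M) :
  PSD N <-> forall X, sums_to_all N X -> projective_coker X.
Proof.
split=> H X NX.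
  have [S [Sp SN SX]] := H X NX.
  have [p [pS pX pid]] := projection_ex SX.
  have [q qE] := submod_lift pS.
  exists (submod_type S), q; split=> //.
    move=> y; exists (\val y); apply: val_inj.
    by rewrite qE pid //; apply: submod_valP.
  move=> x; split=> [qx0|Xx].
    by have := pX x; rewrite -qE qx0 submod_val0 subr0.
  apply: val_inj; rewrite qE submod_val0.
  have : (S `&` X) (p x).
    by split=> //; apply: submodBr (pX x).
  by have [_ ->] := SX.
have [P [p [Pp p_surj p_ker]]] := H X NX.
have [y|h ph Nh] := @projective_section _ _ p N Pp.
  have [x <-] := p_surj y; have /sums_to_allP/(_ x)[n Nn Xn] := NX.
  exists n => //; apply/esym/eqP; rewrite -subr_eq0 -linearB; apply/eqP.
  exact/p_ker.
have himg y : img h (full_submod P) (h y) by exists y.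
have [h' h'E] := submod_lift himg.
exists (img h (full_submod P)); split.
- apply: (@projective_retract P (submod_type (img h (full_submod P)))
    (p \o \val)%FUN h') => // x.
  by apply: val_inj; rewrite h'E /=; have [y _ <-] := submod_valP x; rewrite ph.
- by move=> _ [y _ <-].
split.
  apply/sums_to_allP => m; exists (h (p m)); first exact: himg.
  by apply/p_ker; rewrite linearB ph subrr.
apply/seteqP; split=> [x [[y _ <-]]|x ->].
  by move=> /p_ker; rewrite ph => ->; rewrite linear0.
by split; exact: submod0.
Qed.

(** The definition only yields a summand inside the larger [N]; the criterion [PSDP] does not
    mention where the summand lies. *)
Lemma PSD_sub M (N N' : submodule M) : N' `<=` N -> PSD N -> PSD N'.
Proof.
move=> N'N /PSDP NP; apply/PSDP => X /sums_to_allP NX; apply: NP.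
apply/sums_to_allP => m; have [x ? ?] := NX m; exists x => //; exact: N'N.
Qed.

(* With [f N + X = M], one has [M / X = Q / f^-1 X]. *)
Lemma PSD_img Q M (f : {linear Q -> M}) (N : submodule Q) :
  PSD N -> PSD (img f N).
Proof.
move=> /PSDP NP; apply/PSDP => X /sums_to_allP NX.
have [|P [p [Pp p_surj p_ker]]] := NP (preim f X).
  apply/sums_to_allP => q; have [_ [n Nn <-] Xn] := NX (f q).
  by exists n => //; rewrite /= /preimage /= linearB.
(* Modulo [X], every [m] comes from some [c m] in [N]. The value [p (c m)] is independent of that
   choice, so [p \o c] is linear even though [c] need not be. *)
have /choice[c cX] m : exists n, X (m - f n).
  by have [_ [n _ <-] ?] := NX m; exists n.
have p_uniq n n' : X (f n - f n') -> p n = p n'.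
  rewrite -linearB => Xn; apply/eqP; rewrite -subr_eq0 -linearB; apply/eqP.
  exact/p_ker.
have [|g gE] := @linear_ex M P (p \o c).
  move=> a x y /=; rewrite -linearP; apply: p_uniq; rewrite linearP.
  have -> : f (c (a *: x + y)) - (a *: f (c x) + f (c y)) =
     (a *: (x - f (c x)) + (y - f (c y))) - (a *: x + y - f (c (a *: x + y))).
    by rewrite scalerBr addrACA -opprD opprB [RHS]addrC addrA subrK.
  by apply: submodB => //; apply: submodL.
exists P, g; split=> //.
  move=> y; have [n <-] := p_surj y; exists (f n); rewrite gE /=.
  by apply: p_uniq; rewrite -opprB; apply: submodN.
move=> m; rewrite gE /=; rewrite p_ker /= /preimage /=; split=> Xm.
  by rewrite -[m](subrK (f (c m))); apply: submodD.
exact: submodBr (cX m).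
Qed.

(* If [N1 + N2 + X = M], then [M / X] is an extension of two projective
   modules, hence their product. *)
Lemma PSD_sum M (N1 N2 : submodule M) :
  PSD N1 -> PSD N2 -> PSD (sum_submod N1 N2).
Proof.
move=> NP1 /PSDP NP2; apply/PSDP => X /sums_to_allP NX.
have NX1 : sums_to_all N1 (sum_submod N2 X).
  apply/sums_to_allP => m; have [_ [x1 Nx1 [x2 Nx2 <-]] Xm] := NX m.
  exists x1 => //; exists x2 => //; exists (m - (x1 + x2)) => //.
  by rewrite addrC opprD addrA subrK.
have [S [Sp SN SX]] := NP1 _ NX1.
have [P1 [p1 [P1p p1_surj p1_ker]]] := (PSDP N1).1 NP1 _ NX1.
have [/sums_to_allP SX1 SX0] := SX.
have [|P2 [p2 [P2p p2_surj p2_ker]]] := NP2 (sum_submod X S).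
  apply/sums_to_allP => m; have [s Ss [x2 Nx2 [x Xx mE]]] := SX1 m.
  exists x2 => //; exists x => //; exists s => //.
  by rewrite -[m](subrK s) -mE addrAC [x2 + x]addrC addrK.
(* The kernels N2 + X of [p1] and X + S of [p2] meet exactly in [X], because [S] meets N2 + X in
   0. *)
have [|g gE] := @linear_ex M (P1 * P2)%type (fun x => (p1 x, p2 x)).
  by move=> a x y; rewrite !linearP.
exists (P1 * P2)%type, g; split; first exact: projective_prod.
  move=> [y1 y2].
  have [x1 <-] := p1_surj y1; have [x2 <-] := p2_surj y2.
  have [s1 Ss1 k1] := SX1 x1; have [s2 Ss2 k2] := SX1 x2.
  have p2S s : S s -> p2 s = 0.
    by move=> Ss; apply/p2_ker; exists 0; [exact: submod0|exists s; rewrite ?add0r].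
  move/p1_ker: k1; rewrite linearB => /subr0_eq ->.
  (* [p2] kills [s1] and [p1] kills [x2 - s2], so the two coordinates are reached independently. *)
  exists (s1 + (x2 - s2)); rewrite gE !linearD.
  move/p1_ker: (k2); rewrite linearB => /subr0_eq ->.
  by rewrite !linearN (p2S s1) // (p2S s2) // oppr0 subrr !addr0 add0r.
move=> x; rewrite gE; split=> [[/p1_ker K1 /p2_ker[y Xy [s Ss ysE]]]|Xx].
  have s0 : (S `&` sum_submod N2 X) s.
    split=> //; rewrite -(addKr y s) ysE addrC; apply: submodB => //.
    by exists 0; [exact: submod0|exists y; rewrite ?add0r].
  by move: s0; rewrite SX0 => s0; rewrite -ysE s0 addr0.
have -> : p1 x = 0.
  by apply/p1_ker; exists 0; [exact: submod0|exists x; rewrite ?add0r].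
have -> // : p2 x = 0.
by apply/p2_ker; exists x => //; exists 0; [exact: submod0|rewrite addr0].
Qed.

(** * Supplements presented by linear maps *)

Lemma ideal_mul_img I Q M (f : {linear Q -> M}) x :
  ideal_mul I Q x -> ideal_mul I M (f x).
Proof.
move=> [s [Is ->]]; exists [seq (p.1, f p.2) | p <- s]; split.
  by move=> _ /mapP[p ps ->]; apply: Is.
by rewrite linear_sum big_map; apply: eq_bigr => p _; rewrite linearZ.
Qed.

Lemma ideal_mulD I M x y :
  ideal_mul I M x -> ideal_mul I M y -> ideal_mul I M (x + y).
Proof.
move=> [s [Is ->]] [t [It ->]]; exists (s ++ t); split; last by rewrite big_cat.
by move=> p; rewrite mem_cat => /orP[/Is|/It].
Qed.

(* The image of [j] is then an [I]-supplement of [X]. Not requiring [j] to be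
   injective lets supplements be pushed forward by composition. *)
Definition supplement_map I M (X : submodule M) Q (j : {linear Q -> M}) :
    Prop :=
  [/\ forall m, exists q, X (m - j q), preim j X `<=` ideal_mul I Q
    & PSD (preim j X)].

(** Conversely, let Y be the image of [j]. The intersection of [X] with Y is covered by [preim j X],
    and both conditions pass to images under linear maps. *)
Lemma supplementedP I M : supplemented I M <->
  forall X : submodule M, exists Q (j : {linear Q -> M}), supplement_map I X j.
Proof.
split=> H X.
  have [Y [/sums_to_allP XY YI YP]] := H X.
  exists (submod_type Y), (\val : {linear submod_type Y -> M}); split.
  - move=> m; have [x Xx Yx] := XY m.
    exists (Sub (m - x) (mem_set Yx)).
    by rewrite /= opprB addrC subrK.
  - exact: YI.
  - by apply: PSD_sub YP.
have [Q [j [jX jI jP]]] := H X.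
have jimg y : img j (full_submod Q) (j y) by exists y.
have [k kE] := submod_lift jimg.
have sub : submod_inter X (img j (full_submod Q)) `<=` img k (preim j X).
  move=> y; rewrite /= /preimage /= => Xy; have [q _ jq] := submod_valP y.
  exists q; first by rewrite /= jq.
  by apply: val_inj; rewrite kE.
exists (img j (full_submod Q)); split; last exact/(PSD_sub sub)/PSD_img.
  apply/sums_to_allC/sums_to_allP => m; have [q Xq] := jX m.
  by exists (j q).
by move=> y /sub[q /jI Iq <-]; apply: ideal_mul_img.
Qed.

(** * Supplements in projective modules *)

(* Lift the identity of [M] along [K * Q -> M]. *)
Lemma projective_split M Q (K : submodule M) (j : {linear Q -> M}) :
  projective M -> (forall m, exists q, K (m - j q)) ->
  exists a : {linear M -> Q}, forall m, K (m - j (a m)).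
Proof.
move=> Mp KQ.
have [g gE] := copair_ex (\val : {linear submod_type K -> M}) j.
have [|h hE] := Mp _ _ g idfun.
  move=> m; have [q Kq] := KQ m.
  exists (Sub (m - j q) (mem_set Kq), q).
  by rewrite gE /= subrK.
exists (snd \o h : {linear M -> Q}) => m.
have := hE m; rewrite gE /= => mE; rewrite -{1}mE addrK.
exact: submod_valP.
Qed.

(** [L] lies in N * N', the sum of the images of [N] and [N'] under the two inclusions. *)
Lemma PSD_prod Q Q' (N : submodule Q) (N' : submodule Q')
    (L : submodule (Q * Q')%type) :
  PSD N -> PSD N' -> (forall x, L x -> N x.1 /\ N' x.2) -> PSD L.
Proof.
move=> NP NP' LN.
have [i iE] := inl_linear_ex Q Q'.
have [j jE] := inr_linear_ex Q Q'.
apply: (PSD_sub _ (PSD_sum (PSD_img (f := i) NP) (PSD_img (f := j) NP'))).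
move=> x /LN[Nx Ny].
exists (x.1, 0); first by exists x.1.
by exists (0, x.2); [exists x.2|exact: inl_inr].
Qed.

(* If [j'] supplements the image of [j] inside [K], then the kernel of
   [Q * Q' -> M] is PSD, so that [Q * Q'] is the product of [M] with a
   projective module. *)
Lemma projective_supplement I M (K : submodule M) :
  projective M -> supplemented I M ->
  exists Q (j : {linear Q -> M}), projective Q /\ supplement_map I K j.
Proof.
move=> Mp /supplementedP Ms.
have [Q [j [jK jI jP]]] := Ms K; exists Q, j; split=> //.
pose Y := img j (full_submod Q).
have [Q' [j0 [j0Y j0I j0P]]] := Ms Y.
have [|a aY] := @projective_split M (submod_type K) Y \val Mp.
  move=> m; have [q Kq] := jK m.
  exists (Sub (m - j q) (mem_set Kq)); rewrite /= opprB addrC subrK.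
  by exists q.
(* Composing with [a] moves the supplement [j0] of [Y] into [K] while changing it only modulo
   [Y]. *)
pose j' : {linear Q' -> M} := \val \o (a \o j0).
have j'K q : K (j' q) by apply: submod_valP.
have j'Y q : Y (j' q) -> Y (j0 q).
  by move=> Yq; rewrite -[j0 q](subrK (j' q)); apply: submodD.
have [g gE] := copair_ex j j'.
have [m|h gh _] := @projective_section _ _ g (full_submod _) Mp.
  have [q' [q _ qE]] := j0Y m; have [q1 _ q1E] := aY (j0 q').
  exists (q + q1, q') => //.
  by rewrite gE /= linearD qE q1E -addrA subrK subrK.
(* If j x + j' y = 0, then j x = - j' y lies in both [K] and [Y]. *)
have LP : PSD (preim g (zero_submod M)).
  apply: (PSD_prod jP j0P) => -[x y]; rewrite /= /preimage /= gE /= => xy0.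
  have xE : j x = - j' y by apply/eqP; rewrite -addr_eq0 xy0.
  split; first by rewrite xE; apply: submodN.
  apply: j'Y; rewrite -[j' y]opprK -xE; apply: submodN; by exists x.
(* The section [h] gives Q * Q' = ker g + h(M); as ker g is PSD, the quotient by h(M) is a
   projective [P]. *)
have [|P [p [Pp p_surj p_ker]]] := (PSDP _).1 LP (img h (full_submod M)).
  apply/sums_to_allP => x; exists (x - h (g x)).
    by rewrite /= /preimage /= linearB gh subrr.
  by rewrite opprB addrC subrK; exists (g x).
have ph m : p (h m) = 0 by apply/p_ker; exists m.
have [x|s ps Ks] := @projective_section _ _ p (preim g (zero_submod M)) Pp.
  have [y <-] := p_surj x; exists (y - h (g y)).
    by rewrite /= /preimage /= linearB gh subrr.
  by rewrite linearB ph subr0.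
have [r rE] := copair_ex s h.
have [|i iE] := @linear_ex (Q * Q')%type (P * M)%type (fun x => (p x, g x)).
  by move=> b x y; rewrite !linearP.
(* With [s] splitting [p] inside ker g, this exhibits Q * Q' as a retract of P * M. *)
have ri x : r (i x) = x.
  rewrite rE iE /=.
  have [m _ hm] : img h (full_submod M) (x - s (p x)).
    by apply/p_ker; rewrite linearB ps subrr.
  have <- : m = g x by rewrite -[m]gh hm linearB (Ks (p x)) subr0.
  by rewrite hm addrC subrK.
have QQp : projective (Q * Q')%type.
  by apply: (projective_retract ri); apply: projective_prod.
have [k kE] := inl_linear_ex Q Q'.
by apply: (@projective_retract (Q * Q')%type Q k fst) QQp => x; rewrite kE.
Qed.

(** * Lifting and semiperfect modules *)

Lemma decomposes_idempotent M (e : {linear M -> M}) :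
  (forall x, e (e x) = e x) ->
  decomposes (preim e (zero_submod M)) (img e (full_submod M)).
Proof.
move=> ee; split.
  apply/sums_to_allP => m; exists (m - e m).
    by rewrite /= /preimage /= linearB ee subrr.
  by rewrite opprB addrC subrK; exists m.
apply/seteqP; split=> [x [/= + [y _ yE]]|x ->].
  by rewrite /preimage /= -yE ee.
by split; exact: submod0.
Qed.

Lemma projective_supplemented_lifting I M :
  projective M -> supplemented I M -> lifting I M.
Proof.
move=> Mp Ms K.
have [Q [j [Qp [jK jI jP]]]] := projective_supplement K Mp Ms.
have [a aK] := projective_split Mp jK.
pose aM := img a (full_submod M).
(* Here PSD-ness makes the image of [a] a direct summand of [Q], with complement [S]. *)
have [|S [Sp SK Sa]] := jP aM.
  apply/sums_to_allP => q; exists (q - a (j q)).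
    by rewrite /= /preimage /= linearB.
  by rewrite opprB addrC subrK; exists (j q).
have [p [pS pa pid]] := projection_ex Sa.
have aMa m : aM (a m) by exists m.
have pa0 m : p (a m) = 0.
  have : (S `&` aM) (p (a m)).
    by split=> //; apply: submodBr (pa (a m)).
  by have [_ ->] := Sa.
have [|rho rhoE] := @linear_ex Q Q (fun q => q - p q).
  by move=> b x y; rewrite linearP scalerBr opprD addrACA.
have rhoa q : aM (rho q) by rewrite rhoE.
have [r rE] := submod_lift rhoa; have [b bE] := submod_lift aMa.
(* The projection of [Q] onto the image of [a] lifts through [a], so [t] splits [a] over its
   image. *)
have [|t tE] := Qp _ _ b r.
  move=> x; have [m _ mx] := submod_valP x.
  by exists m; apply: val_inj; rewrite bE.
have at_ q : a (t q) = q - p q by rewrite -rhoE -rE -tE bE.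
pose e : {linear M -> M} := t \o a.
have ae m : a (e m) = a m by rewrite /= at_ pa0 subr0.
have ee m : e (e m) = e m by rewrite [LHS]/= (ae m).
have etimg q : img e (full_submod M) ((e \o t)%FUN q) by exists (t q).
have [k kE] := submod_lift etimg.
(* [a] maps [K] into [preim j K], and [e \o t] recovers [y] from [a y] when [y] is in the image of
   [e]. *)
have sub : submod_inter K (img e (full_submod M)) `<=` img k (preim j K).
  move=> y; rewrite /= /preimage /= => Ky; exists (a (\val y)).
    exact: submodBr (aK (\val y)).
  by apply: val_inj; rewrite kE /=; have [m _ <-] := submod_valP y;
    rewrite [LHS]ee [LHS]ee.
exists (preim e (zero_submod M)), (img e (full_submod M)); split.
- exact: decomposes_idempotent.
(* The kernels of [e] and [a] agree, and m - j (a m) lies in [K]. *)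
- move=> m; rewrite /= /preimage /= => tm0.
  by have := aK m; rewrite -ae [e m]tm0 (linear0 a) (linear0 j) subr0.
- by move=> y /sub[q /jI Iq <-]; apply: ideal_mul_img.
- exact/(PSD_sub sub)/PSD_img.
Qed.

Lemma lifting_supplemented I M : lifting I M -> supplemented I M.
Proof.
move=> Ml X; have [A [B [[/sums_to_allP AB _] AX BI BP]]] := Ml X.
exists B; split=> //; apply/sums_to_allP => m; have [x Ax Bx] := AB m.
by exists x => //; apply: AX.
Qed.

Lemma projective_summand M (A B : submodule M) :
  projective M -> decomposes A B -> projective (submod_type A).
Proof.
move=> Mp AB; have [p [pA _ pid]] := projection_ex AB.
have [q qE] := submod_lift pA.
apply: (@projective_retract M (submod_type A) \val q) Mp => x.
by apply: val_inj; rewrite qE pid //; apply: submod_valP.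
Qed.

Lemma projective_lifting_semiperfect I M :
  projective M -> lifting I M -> semiperfect_module I M.
Proof.
move=> Mp Ml K; have [A [B [AB AK BI BP]]] := Ml K.
exists A, B; split=> //; first exact: projective_summand AB.
move=> x [Kx Bx].
have Ix := BI (Sub x (mem_set Bx)) Kx.
exact: (ideal_mul_img (\val : {linear submod_type B -> M}) Ix).
Qed.

Lemma decomposesC M (A B : submodule M) : decomposes A B -> decomposes B A.
Proof. by move=> [/sums_to_allC ? ?]; split=> //; rewrite setIC. Qed.

(** The assumptions control the intersection of [K] and [B] inside [M]. The projection of [M] onto
    [B] fixes this intersection and carries both PSD-ness and membership in IM over to [B]. *)
Lemma PSD_for_semiperfect_lifting I M :
  PSD_for I M -> semiperfect_module I M -> lifting I M.
Proof.
move=> MP Ms K; have [A [B [AB Ap AK KB]]] := Ms K.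
have [p [pB pA pid]] := projection_ex (decomposesC AB).
have [q qE] := submod_lift pB.
have KBP : PSD (img (\val : {linear submod_type B -> M}) (submod_inter K B)).
  apply: MP => _ [y Ky <-]; apply: KB; split=> //; exact: submod_valP.
have sub : submod_inter K B `<=`
    img q (img (\val : {linear submod_type B -> M}) (submod_inter K B)).
  move=> y Ky; exists (\val y); first by exists y.
  by apply: val_inj; rewrite qE pid //; apply: submod_valP.
exists A, B; split=> //; last exact/(PSD_sub sub)/PSD_img.
move=> y /sub[_ [x Kx <-] <-]; apply: ideal_mul_img; apply: KB; split=> //.
exact: submod_valP.
Qed.

(** * The regular module *)

Lemma scale_map_ex M (a : M) :
  exists f : {linear R^o -> M}, forall r : R, f r = r *: a.
Proof.
apply: (@linear_ex R^o M (fun r : R => r *: a)) => b x y.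
by rewrite scalerDl scalerA.
Qed.

Lemma projective_regular : projective R^o.
Proof.
move=> U V g f g_surj; have [u0 u0E] := g_surj (f 1).
have [h hE] := scale_map_ex u0; exists h => x.
by rewrite hE linearZ u0E -linearZ /= [_ *: _]mulr1.
Qed.

Lemma fin_generated_regular : fin_generated R^o.
Proof.
exists [:: 1 : R^o] => x; exists [:: 1 : R^o], (fun=> x); split=> //.
by rewrite big_seq1 [_ *: _]mulr1.
Qed.

Lemma free_regular : free_module R^o.
Proof.
exists [set 1 : R^o]; split.
  move=> x; exists [:: 1 : R^o], (fun=> x); split.
    by move=> y /=; rewrite inE => /eqP.
  by rewrite big_seq1 [_ *: _]mulr1.
move=> s c s_uniq s1 s0 b bs.
have b1 := s1 b bs; rewrite /= in b1.
(* All members of [s] equal 1 and [s] has no duplicates, so only the term at [b] remains. *)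
move: s0; rewrite (big_rem b) //= big1_seq ?addr0.
  by rewrite b1 => <-; rewrite [RHS]mulr1.
move=> y /andP[_]; rewrite mem_rem_uniq // inE => /andP[yb ys].
by have /= y1 := s1 y ys; rewrite b1 y1 eqxx in yb.
Qed.

(** * Finitely generated modules *)

Lemma projective_trivial Q : (forall x : Q, x = 0) -> projective Q.
Proof.
move=> Q0 U V g f _.
have [|h hE] := @linear_ex Q U (fun=> 0).
  by move=> a x y; rewrite scaler0 addr0.
by exists h => x; rewrite (Q0 x) !linear0.
Qed.

(** The hypothesis says that [U] and [s] together generate [M]. [U] must vary in the induction on
    [s], since each generator removed from [s] is absorbed into [U]; once [s] is empty, [U] is all
    of [M] and the zero module is a supplement. *)
Lemma supplement_map_generated I M (s : seq M) : supplemented I R^o ->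
  forall U : submodule M,
  (forall V : submodule M, U `<=` V -> [set` s] `<=` V -> forall m, V m) ->
  exists Q (j : {linear Q -> M}), supplement_map I U j.
Proof.
move=> /supplementedP Rs; elim: s => [|a s IHs] U Ugen.
  have UT m : U m by apply: Ugen => // x.
  pose Q := submod_type (zero_submod M).
  have Q0 (x : Q) : x = 0.
    by apply: val_inj; rewrite submod_val0; exact: (submod_valP x).
  exists Q, \val; split.
  - by move=> m; exists 0.
  - by move=> x _; exists [::]; split=> //; rewrite big_nil.
  - apply/PSDP => X _; exists Q, idfun; split=> //.
    + exact: projective_trivial.
    + by move=> y; exists y.
    + by move=> x; split=> _ //; rewrite (Q0 x); exact: submod0.
have [f fE] := scale_map_ex a.
have [V UV sV|Q [j [jU jI jP]]] := IHs (sum_submod U (img f (full_submod R^o))).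
  apply: Ugen => x.
    move=> Ux; apply: UV; exists x => //.
    by exists 0; [exact: submod0|rewrite addr0].
  rewrite /= inE => /orP[/eqP ->|xs]; last exact: sV.
  apply: UV; exists 0; first exact: submod0.
  by exists a; [exists 1 => //; rewrite fE scale1r|rewrite add0r].
(* The part of Ra not yet covered by U + j(Q) is supplied by a supplement taken in [R]. *)
have [Q' [j' [j'V j'I j'P]]] :=
  Rs (preim f (sum_submod U (img j (full_submod Q)))).
have [g gE] := copair_ex j (f \o j' : {linear Q' -> M}).
(* If j q + f (j' q') is in [U], each term lies in [U] plus the range of the other map. *)
have sub x : preim g U x ->
    preim j (sum_submod U (img f (full_submod R^o))) x.1 /\
    preim j' (preim f (sum_submod U (img j (full_submod Q)))) x.2.
  rewrite /= /preimage /= gE /= => Ux; split.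
    exists (j x.1 + f (j' x.2)) => //.
    exists (f (- j' x.2)); first by exists (- j' x.2).
    by rewrite linearN addrK.
  exists (j x.1 + f (j' x.2)) => //.
  exists (j (- x.1)); first by exists (- x.1).
  by rewrite linearN addrAC subrr add0r.
exists (Q * Q')%type, g; split; last exact: PSD_prod jP j'P sub.
  move=> m; have [q [u Uu [_ [r _ <-] mE]]] := jU m.
  have [q' [u' Uu' [_ [q1 _ <-] rE]]] := j'V r.
  (* Writing m = u + f r + j q, the remainder f r is in turn u' + j q1 + f (j' q'). *)
  exists (q + q1, q'); rewrite gE /= linearD.
  have -> : m - (j q + j q1 + f (j' q')) = u + u'.
    rewrite -addrA opprD addrA -mE -addrA opprD; congr (_ + _).
    by rewrite addrCA -linearB -rE addrC addrK.
  exact: submodD.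
have [i iE] := inl_linear_ex Q Q'.
have [|i' i'E] := @linear_ex Q' (Q * Q')%type (fun x => (0, x)).
  by move=> b x y; apply/pair_eqP; rewrite /= !eqxx scaler0 addr0 eqxx.
move=> x /sub[/jI Ix /j'I Ix'].
have <- : i x.1 + i' x.2 = x by rewrite iE i'E inl_inr.
by apply: ideal_mulD; apply: ideal_mul_img.
Qed.

Lemma fin_generated_supplemented I M :
  supplemented I R^o -> fin_generated M -> supplemented I M.
Proof.
move=> Rs [s sM]; apply/supplementedP => X.
apply: (supplement_map_generated (s := s)) => // V _ sV m.
have [t [c [ts ->]]] := sM m; elim: t ts => [|b t IHt] ts.
  by rewrite big_nil; exact: submod0.
rewrite big_cons; apply: submodL; first by apply/sV/ts; rewrite /= mem_head.
by apply: IHt => x xt; apply: ts; rewrite /= inE; apply/orP; right.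
Qed.

End Supplements.

Theorem theorem3p3 (R : pzRingType) (I : set R) (hI : two_sided_ideal I) :
  let c1 := forall M : lmodType R, fin_generated M -> supplemented I M in
  let c2 := forall M : lmodType R,
    fin_generated M -> projective M -> supplemented I M in
  let c3 := forall M : lmodType R,
    fin_generated M -> projective M -> lifting I M in
  let c4 := lifting I R^o in
  let c5 := supplemented I R^o in
  let c6 := semiperfect_ring I in
  [/\ c1 -> c2, c2 -> c5 & c5 -> c6] /\
  ((c3 -> c4) /\ (c4 -> c5)) /\
  (left_PSD_ring I -> (c2 -> c3) /\ (c6 -> c1)).
Proof.
have Rfg : fin_generated R^o := fin_generated_regular _.
have Rp : projective R^o by apply: projective_regular.
move=> c1 c2 c3 c4 c5 c6; split; first split.
- by move=> h1 M Mfg _; apply: h1.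
- by move=> h2; apply: h2.
- move=> h5; apply: projective_lifting_semiperfect => //.
  exact: projective_supplemented_lifting.
split; first by split=> [h3|]; [apply: h3|apply: lifting_supplemented].
move=> RPSD; split=> [h2 M Mfg Mp|h6 M Mfg].
  by apply: projective_supplemented_lifting => //; apply: h2.
apply: fin_generated_supplemented Mfg; apply: lifting_supplemented.
apply: PSD_for_semiperfect_lifting => //; apply: RPSD => //.
exact: free_regular.
Qed.
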